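(* Let $X$ be a spectrally extremal regular graph on $n$ vertices of diameter $d$, with distinct eigenvalues $\theta_0 > \dots > \theta_d$. Let $u,v$ be vertices at distance $d$. Then $u$ and $v$ are antipodal if and only if \[ n \prod_{s=0}^{d} \frac{1}{\theta_0 - \theta_s} = \sum_{r=0}^{d} (-1)^r \prod_{s \neq r} \frac{1}{\theta_r - \theta_s}, \] where in the left-hand product the factor with $s=0$ is omitted.
   Context: $X$ is a finite simple connected graph with adjacency matrix $A$. A graph of diameter $d$ has at least $d+1$ distinct eigenvalues; it is called spectrally extremal if it has exactly $d+1$. Write $A = \sum_r \theta_r E_r$ (spectral decomposition, $E_r$ orthogonal projection onto the $\theta_r$-eigenspace), $e_w$ the standard basis vector of $w$. Vertices $u,v$ are cospectral if $X\setminus u$ and $X\setminus v$ have the same adjacency spectrum. Let $\varphi$ be the positive eigenvector of $A$ for its largest eigenvalue and $D = \mathrm{diag}(\varphi)$. A partition of $V(X)$ is pseudo equitable if for each class $C$ and vertex $x$, $\sum_{y \in C}(D^{-1}AD)_{x,y}$ depends only on the class containing $x$ (for regular graphs this is the usual notion of an equitable partition). The distance partition of $u$ is the partition of $V(X)$ into the sets $\{w : d(u,w)=i\}$. Vertices $u$ and $v$ are antipodal if: there is a pseudo equitable partition that is simultaneously the distance partition of $u$ and of $v$; $\{u\}$ and $\{v\}$ are singleton classes of this partition at maximum distance from each other; and $u$ and $v$ are cospectral. *)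

(* Defs.v *)
From HB Require Import structures.
From mathcomp Require Import all_boot all_order all_algebra.
Set Implicit Arguments. Unset Strict Implicit. Unset Printing Implicit Defensive.
Import Order.TTheory GRing.Theory Num.Theory.
Local Open Scope ring_scope.

Section Graphs.
Variables (R : rcfType) (T : finType) (e : rel T).

Definition simple_graph : Prop := symmetric e /\ irreflexive e.
Definition connected_graph : Prop := forall u v : T, connect e u v.
Definition regular_graph : Prop :=
  exists k : nat, forall x : T, #|[set y | e x y]| = k.

Definition adj (x y : T) : R := (e x y)%:R.

Definition adjmx (S : {set T}) : 'M[R]_#|S| :=
  \matrix_(i, j) adj (enum_val i) (enum_val j).

Definition adjX : 'M[R]_#|[set: T]| := adjmx [set: T].

Fixpoint ball (k : nat) (u : T) : {set T} :=
  match k with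
  | 0 => [set u]
  | k'.+1 => ball k' u :|: [set y | [exists x in ball k' u, e x y]]
  end.

(* graph distance (correct for connected graphs, where it is < #|T|) *)
Definition dist (u v : T) : nat := find (fun k => v \in ball k u) (iota 0 #|T|).

Definition diameter_is (d : nat) : Prop :=
  (forall x y : T, dist x y <= d)%N /\ exists x y : T, dist x y = d.

Definition dist_partition (u : T) : {set {set T}} :=
  [set [set w | dist u w == dist u x] | x : T].

Definition perron_vector (phi : T -> R) : Prop :=
  exists lam : R,
    [/\ eigenvalue adjX lam,
        forall mu, eigenvalue adjX mu -> mu <= lam,
        forall x, 0 < phi x &
        forall x, \sum_(y : T) adj x y * phi y = lam * phi x].

(* (D^-1 A D)_{x,y} = A_{x,y} phi y / phi x *)
Definition pseudo_equitable (P : {set {set T}}) : Prop :=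
  forall phi, perron_vector phi ->
  forall C B, C \in P -> B \in P -> forall x y, x \in B -> y \in B ->
    \sum_(z in C) adj x z * phi z / phi x = \sum_(z in C) adj y z * phi z / phi y.

Definition cospectral (u v : T) : Prop :=
  char_poly (adjmx [set~ u]) = char_poly (adjmx [set~ v]).

Definition antipodal (u v : T) : Prop :=
  (exists P : {set {set T}},
     P = dist_partition u /\ P = dist_partition v /\ pseudo_equitable P /\
     [set u] \in P /\ [set v] \in P /\
     (forall x y : T, (dist x y <= dist u v)%N))
  /\ cospectral u v.

End Graphs.

(* Main.v *)
Require Import Defs.
From HB Require Import structures.
From mathcomp Require Import all_boot all_order all_algebra.
From mathcomp Require Import perm spectral complex ring zify.
Set Implicit Arguments. Unset Strict Implicit. Unset Printing Implicit Defensive.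
Import Order.TTheory GRing.Theory Num.Theory.
Local Open Scope ring_scope.

(** Let [E_r] be the spectral idempotents of [A].  As [d(u,v) = d] and
    [prod_(s <> r) (A - theta_s)] has degree [d], the entries [E_r u v] equal
    [m * prod_(s <> r) (theta_r - theta_s)^-1] with [m = (A^d)_(u,v) > 0]; they
    alternate in sign, and [E_0 u v = 1/n].  So the identity in the theorem says
    [sum_r |E_r u v| = 1], i.e. equality in Cauchy-Schwarz:
    [E_r e_u = (-1)^r E_r e_v] for all [r].

    Given this, for each [i <= d] a dimension count gives polynomials [f <> 0] of
    degree at most [i] and [g] of degree at most [d - i] with
    [f(A) e_u = g(A) e_v]; this vector [w_i] is nonzero and lives on the vertices
    at distance [i] from [u] and [d - i] from [v].  The [w_i] have disjoint
    supports, so they form a basis of the [(d+1)]-dimensional Krylov space of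
    [e_u].  That space contains the all-ones vector, so every vertex lies on a
    geodesic from [u] to [v] and [w_i] is a multiple of the indicator of a
    sphere; its invariance under [A] is equitability.  Conversely, if the spheres
    around [u] are equitable, their indicators, and in particular [e_v], lie in
    the Krylov space of [e_u], so [E_r e_v] is proportional to [E_r e_u];
    cospectrality, which is [E_r u u = E_r v v], makes the factor [1] or [-1]. *)

(** * Spectral idempotents of a symmetric matrix *)

(** A symmetric matrix is diagonalizable, so [p(A)] is conjugate to the diagonal matrix of the
    values of [p] at the eigenvalues, all zero. *)
Lemma symmetric_annihilator (R : rcfType) (n : nat) (A : 'M[R]_n.+1) (p : {poly R}) :
  A^T = A -> (forall a, eigenvalue A a -> root p a) -> horner_mx A p = 0.
Proof.
move=> Asym Hp.
(* The spectral theorem is applied over [R[i]]; the eigenvalues it yields are real. *)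
pose toC : {rmorphism R -> R[i]} := real_complex R.
pose B := map_mx toC A.
have Bherm : B \is hermsymmx.
  apply: realsym_hermsym.
    by apply/is_hermitianmxP; rewrite expr0 scale1r map_mx_id // map_trmx Asym.
  by apply/mxOverP => i j; rewrite mxE; apply/complex_realP; exists (A i j).
have PU := spectral_unit B.
have /hermitian_normalmx /orthomx_spectralP := Bherm.
have := hermitian_spectral_diag_real Bherm.
move: PU; set P := spectralmx B; set D := spectral_diag B => PU Dreal BE.
apply: (map_mx_inj (f := toC)); rewrite map_horner_mx map_mx0 -/B.
have -> : B = invmx P *m diag_mx D *m invmx (invmx P) by rewrite invmxK.
rewrite horner_mx_uconj; last first.
  by have : invmx P \in unitmx by rewrite unitmx_inv.
rewrite horner_mx_diag.
suff -> : map_mx (horner (map_poly toC p)) D = 0 by rewrite raddf0 mulmx0 mul0mx.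
apply/rowP => j; rewrite !mxE.
have Dj : D 0 j = toC (complex.Re (D 0 j)).
  by have /mxOverP /(_ 0 j) /complex_realP [x ->] := Dreal.
rewrite Dj horner_map; set a := complex.Re _.
suff : root p a by move/eqP => ->; rewrite rmorph0.
apply: Hp; rewrite eigenvalue_root_char.
suff : eigenvalue B (toC a).
  rewrite eigenvalue_root_char /B -map_char_poly /root horner_map.
  by rewrite -(inj_eq (fmorph_inj toC)) rmorph0.
apply/eigenvalueP; exists (row j P).
  rewrite -row_mul {1}BE !mulmxA mulmxV // mul1mx -Dj.
  by rewrite row_mul row_diag_mx -scalemxAl -rowE.
apply/eqP => /rowP P0.
have := mulmxV PU => /matrixP /(_ j j).
rewrite !mxE eqxx big1 => [/eqP|k _]; first by rewrite eq_sym oner_eq0.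
by have := P0 k; rewrite !mxE => ->; rewrite mul0r.
Qed.

Lemma trmx_horner (R : comNzRingType) (n : nat) (A : 'M[R]_n.+1) (p : {poly R}) :
  (horner_mx A p)^T = horner_mx A^T p.
Proof.
elim/poly_ind: p => [|p c IH]; first by rewrite !rmorph0 trmx0.
rewrite !rmorphD !rmorphM /= !horner_mx_C !horner_mx_X linearD /= tr_scalar_mx.
congr (_ + _); rewrite -IH -[LHS]/((horner_mx A p *m A)^T) trmx_mul IH.
exact/esym/comm_horner_mx.
Qed.

(** Polynomials that agree at every [theta r] agree at [A], so identities among Lagrange
    polynomials, checked at these points, pass to matrices. *)
Lemma spectral_idempotents (R : rcfType) (n d : nat) (A : 'M[R]_n) (theta : 'I_d -> R) :
  A^T = A -> injective theta ->
  (forall a, eigenvalue A a -> exists r, a = theta r) ->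
  exists E : 'I_d -> 'M[R]_n,
    [/\ forall r, (E r)^T = E r,
        \sum_r E r = 1%:M,
        forall r s, E r *m E s = (r == s)%:R *: E r &
        forall r, A *m E r = theta r *: E r].
Proof.
case: n A => [|n] A Asym thI eigA.
  by exists (fun=> 0); split => *; apply/matrixP => -[].
have agree p q : (forall s, p.[theta s] = q.[theta s]) -> horner_mx A p = horner_mx A q.
  move=> pq; apply/eqP; rewrite -subr_eq0 -rmorphB /=; apply/eqP.
  apply: symmetric_annihilator => // a /eigA [s ->].
  by rewrite /root hornerD hornerN pq subrr.
(* The idempotents are the Lagrange polynomials [L r] evaluated at [A]. *)
pose L r : {poly R} := \prod_(s | s != r) ((theta r - theta s)^-1 *: ('X - (theta s)%:P)).
have LE r t : (L r).[theta t] = (r == t)%:R.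
  rewrite horner_prod; case: eqVneq => [<-|rt].
    apply: big1 => s sr; rewrite hornerZ hornerXsubC mulVf //.
    by rewrite subr_eq0 (inj_eq thI) eq_sym.
  by rewrite (bigD1 t) 1?eq_sym //= hornerZ hornerXsubC subrr mulr0 mul0r.
exists (fun r => horner_mx A (L r)); split.
- by move=> r; rewrite trmx_horner Asym.
- rewrite -rmorph_sum /= -(horner_mx_C A 1); apply: agree => s.
  rewrite horner_sum hornerC (bigD1 s) //= big1 => [|r rs]; rewrite LE ?eqxx ?addr0 //.
  by rewrite (negbTE rs).
- move=> r s; rewrite -[LHS]/(horner_mx A (L r) * horner_mx A (L s)) -rmorphM /=.
  rewrite -horner_mxZ; apply: agree => t; rewrite hornerM hornerZ !LE.
  case: (eqVneq r s) => [->|rs]; first by rewrite mul1r -natrM mulnb andbb.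
  rewrite mul0r; case: eqVneq => [<-|]; last by rewrite mul0r.
  by rewrite eq_sym (negbTE rs) mulr0.
move=> r; rewrite -[LHS]/(A * horner_mx A (L r)) -{1}(horner_mx_X A) -rmorphM /=.
rewrite -horner_mxZ; apply: agree => t; rewrite hornerM hornerX hornerZ LE.
by case: eqVneq => [->|]; rewrite ?mulr0.
Qed.

(** * Vertex-deleted characteristic polynomials *)

(** Two enumerations of one set differ by a permutation of both rows and columns, whose sign enters
    the determinant twice. *)
Lemma det_reindex (S : comNzRingType) (T : finType) (F : T -> T -> S) (n m : nat)
    (f : 'I_n -> T) (g : 'I_m -> T) :
  injective f -> injective g -> codom f =i codom g ->
  \det (\matrix_(i, j) F (f i) (f j)) = \det (\matrix_(i, j) F (g i) (g j)).
Proof.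
move=> fI gI fg.
have nm : n = m.
  by rewrite -(card_ord n) -(card_codom fI) -(card_ord m) -(card_codom gI); apply: eq_card.
subst m.
have gf i : g i \in codom f by rewrite fg codom_f.
pose s i := iinv (gf i).
have fs i : f (s i) = g i by rewrite /s f_iinv.
have sI : injective s by move=> i j /(congr1 f); rewrite !fs => /gI.
pose M := \matrix_(i, j) F (f i) (f j).
have -> : \matrix_(i, j) F (g i) (g j) = row_perm (perm sI) (col_perm (perm sI) M).
  by apply/matrixP => i j; rewrite !mxE !permE !fs.
rewrite row_permE col_permE !det_mulmx !det_perm odd_permV mulrC -mulrA.
by rewrite -expr2 sqrr_sign mulr1.
Qed.

Lemma char_poly_adjmx (R : rcfType) (T : finType) (e : rel T) (S : {set T}) :
  char_poly (adjmx R e S) =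
  \det (\matrix_(i < #|S|, j < #|S|)
    ((enum_val i == enum_val j)%:R * 'X - (adj R e (enum_val i) (enum_val j))%:P)).
Proof.
congr (\det _); apply/matrixP => i j; rewrite !mxE (inj_eq enum_val_inj).
by case: eqP; rewrite ?mul1r ?mul0r.
Qed.

(** Enumerating the remaining vertices need not match deleting a row and a column of the full
    enumeration, hence [det_reindex]. *)
Lemma char_poly_deleted (R : rcfType) (T : finType) (e : rel T) (i : 'I_#|[set: T]|) :
  char_poly (adjmx R e [set~ enum_val i]) = cofactor (char_poly_mx (adjX R e)) i i.
Proof.
rewrite char_poly_adjmx /cofactor -signr_odd addnn odd_double expr0 mul1r.
pose F x y : {poly R} := (x == y)%:R * 'X - (adj R e x y)%:P.
have -> : row' i (col' i (char_poly_mx (adjX R e))) =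
    \matrix_(j, k) F (enum_val (lift i j)) (enum_val (lift i k)).
  apply/matrixP => j k; rewrite !mxE /F (inj_eq enum_val_inj).
  by case: eqP; rewrite ?mul1r ?mul0r.
apply: (@det_reindex _ _ F) => [|j k /enum_val_inj /lift_inj //|x]; first exact: enum_val_inj.
have E : (x \in codom (fun j : 'I_#|[set~ enum_val i]| => enum_val j)) = (x != enum_val i).
  apply/codomP/idP => [[j ->]|xi]; first by have := enum_valP j; rewrite !inE.
  have xin : x \in [set~ enum_val i] by rewrite !inE.
  by exists (enum_rank_in xin x); rewrite enum_rankK_in.
rewrite [LHS]E; apply/idP/codomP => [|[j ->]].
  have xin := in_setT x; have := enum_rankK_in xin xin.
  set k := enum_rank_in _ _ => <-; rewrite (inj_eq enum_val_inj).
  by case: (unliftP i k) => [j ->|->]; [exists j | rewrite eqxx].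
by rewrite (inj_eq enum_val_inj) eq_sym neq_lift.
Qed.

(** This is the resolvent expansion [(X - A)^-1 = \sum_r E r / (X - theta r)] with denominators
    cleared: multiply [(X - A) G = mu] by the adjugate. *)
Lemma cofactor_char_poly (R : fieldType) (n d : nat) (A : 'M[R]_n) (theta : 'I_d -> R)
    (E : 'I_d -> 'M[R]_n) (i : 'I_n) :
  \sum_r E r = 1%:M -> (forall r, A *m E r = theta r *: E r) ->
  (\prod_s ('X - (theta s)%:P)) * cofactor (char_poly_mx A) i i =
  char_poly A * \sum_r (\prod_(s | s != r) ('X - (theta s)%:P)) * (E r i i)%:P.
Proof.
move=> sumE eigE; set mu := \prod_s _.
pose G := \sum_r (\prod_(s | s != r) ('X - (theta s)%:P)) *: map_mx polyC (E r).
have MG : char_poly_mx A *m G = mu%:M.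
  rewrite mulmx_sumr -scalemx1.
  have -> : 1%:M = \sum_r map_mx polyC (E r) :> 'M[{poly R}]_n.
    by rewrite -map_mx_sum sumE map_mx1.
  rewrite scaler_sumr; apply: eq_bigr => r _.
  rewrite -scalemxAr mulmxBl mul_scalar_mx -map_mxM eigE map_mxZ -scalerBl scalerA.
  by rewrite mulrC /mu [in RHS](bigD1 r).
have : mu *: \adj (char_poly_mx A) = char_poly A *: G.
  by rewrite -mul_mx_scalar -MG mulmxA mul_adj_mx mul_scalar_mx.
move/matrixP/(_ i i); rewrite !mxE => ->; congr (_ * _).
by rewrite summxE; apply: eq_bigr => r _; rewrite !mxE.
Qed.

Lemma adj_spectral (R : rcfType) (T : finType) (e : rel T) (d : nat) (theta : 'I_d -> R) :
  symmetric e -> injective theta ->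
  (forall a, eigenvalue (adjX R e) a -> exists r, a = theta r) ->
  exists E : 'I_d -> T -> T -> R,
    [/\ forall r x y, E r x y = E r y x,
        forall x y, \sum_r E r x y = (x == y)%:R,
        forall r s x y, \sum_z E r x z * E s z y = (r == s)%:R * E r x y,
        forall r x y, \sum_z adj R e x z * E r z y = theta r * E r x y &
        forall u v, cospectral R e u v <-> forall r, E r u u = E r v v].
Proof.
move=> e_sym thI eigA.
have Asym : (adjX R e)^T = adjX R e by apply/matrixP => i j; rewrite !mxE /adj e_sym.
have [E [Esym sumE EE eigE]] := @spectral_idempotents _ _ _ _ theta Asym thI eigA.
pose rk (x : T) := enum_rank_in (in_setT x) x.
have rkK x : enum_val (rk x) = x by rewrite enum_rankK_in.
have rkV i : rk (enum_val i) = i by apply: enum_val_inj; rewrite rkK.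
have rkI : injective rk by apply: can_inj rkK.
have sum_rk (F : 'I_#|[set: T]| -> R) : \sum_z F (rk z) = \sum_i F i.
  by rewrite [RHS](reindex rk) //; apply: onW_bij; exists (fun i => enum_val i).
exists (fun r x y => E r (rk x) (rk y)); split.
- by move=> r x y; rewrite -{1}Esym mxE.
- by move=> x y; rewrite -summxE sumE mxE (inj_eq rkI).
- move=> r s x y; rewrite (sum_rk (fun z => E r (rk x) z * E s z (rk y))).
  by move: (EE r s) => /matrixP /(_ (rk x) (rk y)); rewrite !mxE.
- move=> r x y; move: (eigE r) => /matrixP /(_ (rk x) (rk y)).
  rewrite !mxE -sum_rk => <-; apply: eq_bigr => z _.
  by rewrite mxE !rkK.
pose mu : {poly R} := \prod_s ('X - (theta s)%:P).
pose chi := char_poly (adjX R e).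
pose S x : {poly R} := \sum_r (\prod_(s | s != r) ('X - (theta s)%:P)) * (E r (rk x) (rk x))%:P.
have key x : mu * char_poly (adjmx R e [set~ x]) = chi * S x.
  have := @char_poly_deleted R T e (rk x); rewrite rkK => ->.
  exact: cofactor_char_poly sumE eigE.
have mu0 : mu != 0 by rewrite monic_neq0 // monic_prod_XsubC.
have chi0 : chi != 0 by rewrite monic_neq0 // char_poly_monic.
(* At [theta t] only the term of [E t] survives, so [S x] determines the diagonal entries at [x]. *)
have SE x t : (S x).[theta t] = (\prod_(s | s != t) (theta t - theta s)) * E t (rk x) (rk x).
  rewrite horner_sum (bigD1 t) //= [X in _ + X]big1 ?addr0 => [|r rt].
    rewrite hornerM hornerC horner_prod; congr (_ * _).
    by apply: eq_bigr => s _; rewrite hornerXsubC.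
  by rewrite hornerM horner_prod (bigD1 t) 1?eq_sym //= hornerXsubC subrr !mul0r.
move=> u v; split => [cuv t|Euv].
  have : S u = S v by apply: (mulfI chi0); rewrite -!key cuv.
  move=> /(congr1 (fun p => p.[theta t])); rewrite !SE; apply: mulfI.
  by apply/prodf_neq0 => s st; rewrite subr_eq0 (inj_eq thI) eq_sym.
apply: (mulfI mu0); rewrite !key; congr (_ * _).
by apply: eq_bigr => r _; rewrite Euv.
Qed.

(** * Distance and walks *)

Section Distance.
Variables (T : finType) (e : rel T).
Hypotheses (e_sym : symmetric e) (econn : connected_graph e).
Implicit Types (x y z : T) (i j k : nat).

Lemma ballSE k x y : (y \in ball e k.+1 x) = (y \in ball e k x) || [exists z in ball e k x, e z y].
Proof. by rewrite !inE. Qed.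

Lemma ball_edge k x y z : z \in ball e k x -> e z y -> y \in ball e k.+1 x.
Proof. by move=> zx ezy; rewrite ballSE; apply/orP; right; apply/existsP; exists z; rewrite zx. Qed.

Lemma ball_mono i j x y : (i <= j)%N -> y \in ball e i x -> y \in ball e j x.
Proof.
elim: j => [|j IH]; first by rewrite leqn0 => /eqP ->.
by rewrite leq_eqVlt => /orP[/eqP -> //|/IH H /H yx]; rewrite ballSE yx.
Qed.

Lemma ball_trans i j x y z : z \in ball e i x -> y \in ball e j z -> y \in ball e (i + j) x.
Proof.
move=> zx; elim: j y => [|j IH] y; first by rewrite inE addn0 => /eqP ->.
rewrite ballSE addnS => /orP[/IH|/existsP[t /andP[/IH tx ety]]]; last exact: ball_edge tx ety.
exact: ball_mono.
Qed.

Lemma ball_sym k x y : y \in ball e k x -> x \in ball e k y.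
Proof.
elim: k y => [|k IH] y; first by rewrite !inE eq_sym.
rewrite ballSE => /orP[/IH|/existsP[z /andP[/IH xz ezy]]]; first exact: ball_mono.
have zy : z \in ball e 1 y by apply: (@ball_edge 0 y z y); rewrite ?inE // e_sym.
exact: (ball_trans zy xz).
Qed.

Lemma mem_ball_path x p : path e x p -> last x p \in ball e (size p) x.
Proof.
elim/last_ind: p => [|p z IH]; first by rewrite inE.
rewrite rcons_path last_rcons size_rcons => /andP[/IH px]; exact: ball_edge.
Qed.

(** The search in [dist] succeeds because a duplicate-free path has fewer than [#|T|] edges. *)
Lemma mem_ball k x y : (y \in ball e k x) = (dist e x y <= k)%N.
Proof.
have hasP : has (fun k => y \in ball e k x) (iota 0 #|T|).
  have /connectP [p0 p0P yE] := econn x y.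
  case: (shortenP p0P) yE => p pP pU _ yE.
  apply/hasP; exists (size p); last by rewrite yE mem_ball_path.
  by rewrite mem_iota add0n -[(size p).+1]/(size (x :: p)) -(card_uniqP pU) max_card.
have dlt : (dist e x y < #|T|)%N by rewrite -[X in (_ < X)%N](size_iota 0) -has_find.
have := nth_find 0 hasP; rewrite -/(dist e x y) nth_iota // add0n => yd.
apply/idP/idP => [yk|dk]; last exact: ball_mono yd.
rewrite leqNgt; apply/negP => kd.
have := before_find 0 kd; rewrite nth_iota ?add0n ?yk //; exact: ltn_trans dlt.
Qed.

Lemma dist_sym x y : dist e x y = dist e y x.
Proof.
by apply/eqP; rewrite eqn_leq -!mem_ball; apply/andP; split; apply: ball_sym; rewrite mem_ball.
Qed.

Lemma dist_triangle x y z : (dist e x z <= dist e x y + dist e y z)%N.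
Proof. by rewrite -mem_ball; apply: (@ball_trans _ _ _ _ y); rewrite mem_ball. Qed.

Lemma dist_eq0 x y : (dist e x y == 0)%N = (x == y).
Proof. by rewrite -leqn0 -mem_ball inE eq_sym. Qed.

End Distance.

Section WalkCount.
Variables (R : rcfType) (T : finType) (e : rel T).

(** This is the entry of [A^k] at [(y, x)]. *)
Fixpoint walk_count (k : nat) (y x : T) : R :=
  if k is k'.+1 then \sum_z adj R e y z * walk_count k' z x else (y == x)%:R.

Lemma walk_count_ge0 k y x : 0 <= walk_count k y x.
Proof.
elim: k y => [|k IH] y /=; first exact: ler0n.
by apply: sumr_ge0 => z _; rewrite mulr_ge0 // ler0n.
Qed.

Hypotheses (e_sym : symmetric e) (econn : connected_graph e).

Lemma walk_count_eq0 k y x : (k < dist e x y)%N -> walk_count k y x = 0.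
Proof.
rewrite ltnNge -mem_ball //; elim: k y => [|k IH] y /=; first by rewrite inE => /negbTE ->.
move=> yk; apply: big1 => z _; rewrite /adj.
have [eyz|] := boolP (e y z); last by rewrite mul0r.
rewrite IH ?mulr0 //; apply: contra yk => zk.
by apply: (ball_edge zk); rewrite e_sym.
Qed.

(** A neighbour of [y] one step closer to [x] contributes a positive term. *)
Lemma walk_count_gt0 y x : 0 < walk_count (dist e x y) y x.
Proof.
move: {2}(dist e x y) (erefl (dist e x y)) => k dk; rewrite dk; elim: k y dk => [|k IH] y dk /=.
  by move/eqP: dk; rewrite dist_eq0 // eq_sym => ->; rewrite ltr01.
have : y \in ball e k.+1 x by rewrite mem_ball // dk.
rewrite ballSE mem_ball // dk ltnn => /existsP[z /andP[zk ezy]].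
have dz : dist e x z = k.
  apply/eqP; rewrite eqn_leq -mem_ball // zk /= -ltnS -dk -mem_ball //.
  by apply: ball_edge ezy; rewrite mem_ball.
rewrite (bigD1 z) //= ltr_pwDl //.
  by rewrite mulr_gt0 ?IH // /adj e_sym ezy ltr01.
by apply: sumr_ge0 => t _; rewrite mulr_ge0 ?ler0n // walk_count_ge0.
Qed.

End WalkCount.

(** * Perron vectors of regular graphs *)

Section Regular.
Variables (R : rcfType) (T : finType) (e : rel T) (k : nat).
Hypotheses (e_sym : symmetric e) (econn : connected_graph e).
Hypothesis (ereg : forall x : T, #|[set y | e x y]| = k).

Lemma sum_adj x : \sum_y adj R e x y = k%:R.
Proof.
rewrite -(ereg x) -sum1_card natr_sum big_mkcond [RHS]big_mkcond /=.
by apply: eq_bigr => y _; rewrite inE /adj; case: (e x y).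
Qed.

(** Serves twice: Perron vectors and the columns of [E ord0] are eigenvectors for the degree [k]. *)
Lemma harmonic_const (f : T -> R) :
  (forall x, \sum_y adj R e x y * f y = k%:R * f x) -> forall x y, f x = f y.
Proof.
move=> fh; suff H (x : T) : exists m, forall z, f z = m.
  by move=> x y; have [m fm] := H x; rewrite !fm.
(* Maximum principle: the set where [f] is maximal is closed under adjacency. *)
case: (@arg_maxP _ _ _ x xpredT f isT) => m _ fmax; exists (f m) => z.
have /connectP [p pP ->] := econn m z.
elim/last_ind: p pP => [//|p y IH]; rewrite rcons_path last_rcons => /andP[/IH {}IH ey].
set x' := last m p in IH ey.
have S0 : \sum_y adj R e x' y * (f m - f y) = 0.
  under eq_bigr do rewrite mulrBr.
  by rewrite sumrB -mulr_suml sum_adj fh IH subrr.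
have Sge t : true -> 0 <= adj R e x' t * (f m - f t).
  by move=> _; rewrite mulr_ge0 ?ler0n // subr_ge0; exact: fmax.
have /eqP := @psumr_eq0P _ _ xpredT _ Sge S0 y isT.
by rewrite /adj ey mul1r subr_eq0 => /eqP.
Qed.

(** [eigenvalue] speaks of row vectors; the symmetry of [e] lets [A] act from the left instead. *)
Lemma eigenvalue_adjXP (a : R) :
  eigenvalue (adjX R e) a <->
  exists f : T -> R, (exists x, f x != 0) /\ forall x, \sum_y adj R e x y * f y = a * f x.
Proof.
pose rk (x : T) := enum_rank_in (in_setT x) x.
have rkK x : enum_val (rk x) = x by rewrite enum_rankK_in.
have rkV i : rk (enum_val i) = i by apply: enum_val_inj; rewrite rkK.
have sum_rk (F : 'I_#|[set: T]| -> R) : \sum_z F (rk z) = \sum_i F i.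
  by rewrite [RHS](reindex rk) //; apply: onW_bij; exists (fun i => enum_val i).
split=> [/eigenvalueP[v vA v0]|[f [[x fx] fh]]].
  exists (fun x => v 0 (rk x)); split.
    by have /rV0Pn [i vi] := v0; exists (enum_val i); rewrite rkV.
  move=> x; move/rowP/(_ (rk x)): vA; rewrite !mxE -sum_rk => <-.
  by apply: eq_bigr => y _; rewrite mxE !rkK mulrC /adj e_sym.
apply/eigenvalueP; exists (\row_i f (enum_val i)); last first.
  by apply/rV0Pn; exists (rk x); rewrite mxE rkK.
apply/rowP => i; rewrite !mxE -fh -sum_rk; apply: eq_bigr => y _.
by rewrite !mxE rkK mulrC /adj e_sym.
Qed.

(** Compare both sides of the eigenvector equation at a vertex where [|f|] is largest. *)
Lemma eigenvalue_le_degree (a : R) : eigenvalue (adjX R e) a -> a <= k%:R.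
Proof.
move=> /eigenvalue_adjXP [f [[x fx] fh]].
case: (@arg_maxP _ _ _ x xpredT (fun y => `|f y|) isT) => m _ fmax.
have fm : 0 < `|f m| by apply: lt_le_trans (fmax x isT); rewrite normr_gt0.
rewrite -(ler_pM2r fm); apply: (@le_trans _ _ `|a * f m|).
  by rewrite normrM ler_wpM2r // ler_norm.
rewrite -fh -(sum_adj m) mulr_suml; apply: le_trans (ler_norm_sum _ _ _) _.
apply: ler_sum => y _; rewrite normrM ger0_norm ?ler0n //.
by rewrite ler_wpM2l ?ler0n //; exact: fmax.
Qed.

Lemma degree_eigenvalue (x : T) : eigenvalue (adjX R e) (k%:R : R).
Proof.
apply/eigenvalue_adjXP; exists (fun=> 1); split; first by exists x; rewrite oner_neq0.
by move=> y; rewrite -mulr_suml sum_adj.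
Qed.

Lemma perron_vector_one (x : T) : perron_vector e (fun=> 1 : R).
Proof.
exists k%:R; split; [exact: degree_eigenvalue|exact: eigenvalue_le_degree| |].
  by move=> y; exact: ltr01.
by move=> y; rewrite -mulr_suml sum_adj.
Qed.

Lemma perron_vector_const (phi : T -> R) :
  perron_vector e phi -> forall x y, phi x = phi y.
Proof.
move=> [a [_ _ phi0 phih]]; apply: harmonic_const => x.
rewrite phih; congr (_ * _).
(* Summing [A phi = a phi] over all vertices gives [k S = a S], where [S] is the positive sum of
   [phi]. *)
have S0 : 0 < \sum_x phi x.
  by rewrite (bigD1 x) //= ltr_pwDl // sumr_ge0 // => y _; exact: ltW.
apply: (mulIf (lt0r_neq0 S0)); rewrite mulr_sumr.
under eq_bigr do rewrite -phih.
rewrite exchange_big /= mulr_sumr; apply: eq_bigr => y _.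
by rewrite -mulr_suml -(sum_adj y); congr (_ * _); apply: eq_bigr => z _; rewrite /adj e_sym.
Qed.

End Regular.

(** * Vertices at distance d *)

Lemma poly_eq0_on (F : idomainType) (m : nat) (theta : 'I_m -> F) (p : {poly F}) :
  injective theta -> (size p <= m)%N -> (forall r, p.[theta r] = 0) -> p = 0.
Proof.
move=> thI szp p0; apply: (@roots_geq_poly_eq0 _ p (map theta (enum 'I_m))).
- by apply/allP => _ /mapP[r _ ->]; apply/eqP.
- by rewrite map_inj_uniq ?enum_uniq.
- by rewrite size_map size_enum_ord.
Qed.

Lemma horner_rVpoly_sum (F : nzSemiRingType) (n : nat) (w : 'rV[F]_n) (x : F) :
  (rVpoly w).[x] = \sum_j w 0 j * x ^+ j.
Proof. by rewrite horner_poly; apply: eq_bigr => j _; rewrite valK. Qed.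

(** With signs for [sigma], this yields [f(A) e_u = g(A) e_v] when the projections of [e_u] and
    [e_v] differ by these signs. *)
Lemma two_poly_interpolation (F : fieldType) (d i : nat) (theta sigma : 'I_d.+1 -> F) :
  injective theta -> (forall r, sigma r != 0) -> (i <= d)%N ->
  exists f g : {poly F},
    [/\ (size f <= i.+1)%N, (size g <= (d - i).+1)%N, f != 0 &
        forall r, f.[theta r] = sigma r * g.[theta r]].
Proof.
move=> thI s0 id.
(* [d + 2] unknown coefficients, [d + 1] linear equations. *)
pose M : 'M[F]_(i.+1 + (d - i).+1, d.+1) :=
  col_mx (\matrix_(a, r) theta r ^+ a) (\matrix_(b, r) - (sigma r * theta r ^+ b)).
have : kermx M != 0.
  rewrite kermx_eq0 /row_free neq_ltn; apply/orP; left.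
  by apply: leq_ltn_trans (rank_leq_col M) _; lia.
move=> /rowV0Pn [w /sub_kermxP wM w0].
pose f := rVpoly (lsubmx w); pose g := rVpoly (rsubmx w).
have fg r : f.[theta r] = sigma r * g.[theta r].
  move/rowP/(_ r): wM; rewrite -{1}(hsubmxK w) mul_row_col !mxE => /eqP.
  rewrite addr_eq0 => /eqP H; rewrite !horner_rVpoly_sum.
  have -> : \sum_j lsubmx w 0 j * theta r ^+ j =
      \sum_j lsubmx w 0 j * (\matrix_(a < i.+1, r0 < d.+1) theta r0 ^+ a) j r.
    by apply: eq_bigr => j _; rewrite mxE.
  rewrite H mulr_sumr -sumrN; apply: eq_bigr => j _.
  by rewrite !mxE mulrN opprK mulrCA.
have szf : (size f <= i.+1)%N by exact: size_poly.
have szg : (size g <= (d - i).+1)%N by exact: size_poly.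
(* If [f = 0], then [g] has [d + 1] roots, more than its degree allows, so [w = 0]. *)
exists f, g; split=> //; apply: contraNneq w0 => f0.
have g0 : g = 0.
  apply: (@poly_eq0_on _ _ theta) => // [|r]; first by apply: leq_trans szg _; lia.
  by have /esym/eqP := fg r; rewrite f0 horner0 mulf_eq0 (negbTE (s0 r)) => /eqP.
rewrite -(hsubmxK w) -(rVpolyK (lsubmx w)) -(rVpolyK (rsubmx w)) -/f -/g f0 g0.
by rewrite !linear0 row_mx0.
Qed.

(** * Polynomials in the adjacency matrix, entry by entry *)

Section Idempotents.
Variables (R : rcfType) (T : finType) (e : rel T) (d : nat).
Variables (theta : 'I_d.+1 -> R) (E : 'I_d.+1 -> T -> T -> R).
Hypotheses (e_sym : symmetric e) (econn : connected_graph e).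
Hypothesis thI : injective theta.
Hypothesis Esym : forall r x y, E r x y = E r y x.
Hypothesis sumE : forall x y, \sum_r E r x y = (x == y)%:R.
Hypothesis EE : forall r s x y, \sum_z E r x z * E s z y = (r == s)%:R * E r x y.
Hypothesis AE : forall r x y, \sum_z adj R e x z * E r z y = theta r * E r x y.

(** As functions of [x], the sums [\sum_r q r * E r x y] form the Krylov space of [e_y]; here [A]
    acts on their coefficients. *)
Lemma adj_comb (q : 'I_d.+1 -> R) x y :
  \sum_z adj R e x z * (\sum_r q r * E r z y) = \sum_r theta r * q r * E r x y.
Proof.
under eq_bigr do rewrite mulr_sumr.
rewrite exchange_big /=; apply: eq_bigr => r _.
by rewrite mulrAC -AE mulr_suml; apply: eq_bigr => z _; rewrite mulrCA mulrC.
Qed.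

Lemma idem_comb (q : 'I_d.+1 -> R) r x y :
  \sum_z E r x z * (\sum_s q s * E s z y) = q r * E r x y.
Proof.
under eq_bigr do rewrite mulr_sumr.
rewrite exchange_big /= (bigD1 r) //= [X in _ + X]big1 ?addr0 => [|s sr].
  under eq_bigr do rewrite mulrCA.
  by rewrite -mulr_sumr EE eqxx mul1r.
under eq_bigr do rewrite mulrCA.
by rewrite -mulr_sumr EE eq_sym (negbTE sr) mul0r mulr0.
Qed.

Lemma walk_count_spectral k x y :
  walk_count R e k x y = \sum_r theta r ^+ k * E r x y.
Proof.
elim: k x => [|k IH] x /=; first by rewrite -sumE; apply: eq_bigr => r _; rewrite mul1r.
under eq_bigr do rewrite IH.
by rewrite adj_comb; apply: eq_bigr => r _; rewrite exprS.
Qed.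

Lemma poly_spectral (f : {poly R}) m x y : (size f <= m)%N ->
  \sum_r f.[theta r] * E r x y = \sum_(k < m) f`_k * walk_count R e k x y.
Proof.
move=> fm; under eq_bigr do rewrite (horner_coef_wide _ fm) mulr_suml.
rewrite exchange_big /=; apply: eq_bigr => k _.
by rewrite walk_count_spectral mulr_sumr; apply: eq_bigr => r _; rewrite mulrA.
Qed.

(** [size] is the degree plus one, so only powers of [A] too small to join [x] and [y] occur. *)
Lemma poly_spectral_far (f : {poly R}) x y : (size f <= dist e x y)%N ->
  \sum_r f.[theta r] * E r x y = 0.
Proof.
move=> fd; rewrite (poly_spectral _ _ fd); apply: big1 => k _.
by rewrite walk_count_eq0 ?mulr0 //; apply: leq_trans (ltn_ord k) _; rewrite dist_sym.
Qed.

(** As [E r] is a symmetric idempotent, the inner product of [E r e_x] and [E r e_y] is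
    [E r x y]. *)
Lemma idem_norm r x y (c : R) :
  \sum_z (E r z x - c * E r z y) ^+ 2 = E r x x + c ^+ 2 * E r y y - 2 * c * E r x y.
Proof.
have H a b : \sum_z E r z a * E r z b = E r a b.
  have := EE r r a b; rewrite eqxx mul1r => <-.
  by apply: eq_bigr => z _; rewrite (Esym r z a).
rewrite -!H !mulr_sumr -big_split -sumrB /=; apply: eq_bigr => z _; ring.
Qed.

Section Far.
Variables (u v : T).
Hypothesis duv : dist e u v = d.

(** Compute the entry of [f(A)] at [(u, v)] twice, for [f] the product of the [X - theta s] with
    [s != r]: spectrally only [E r] survives, and among the powers of [A] only the leading one
    reaches distance [d]. *)
Lemma idem_far r : (\prod_(s | s != r) (theta r - theta s)) * E r u v = walk_count R e d u v.
Proof.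
pose f : {poly R} := \prod_(s | s != r) ('X - (theta s)%:P).
have szf : size f = d.+1.
  rewrite size_prod => [|s _]; last exact: negbT (polyXsubC_eq0 _).
  under eq_bigr do rewrite size_XsubC.
  by rewrite sum_nat_const cardC1 card_ord /=; lia.
have := @poly_spectral f d.+1 u v; rewrite szf => /(_ (leqnn _)).
rewrite [RHS]big_ord_recr /= [X in _ = X + _]big1 ?add0r => [|k _]; last first.
  by rewrite walk_count_eq0 ?mulr0 // dist_sym // duv.
have -> : f`_d = 1.
  have /monicP : f \is monic by exact: monic_prod_XsubC.
  by rewrite /lead_coef szf.
rewrite mul1r => <-; rewrite [RHS](bigD1 r) //= [X in _ = _ + X]big1 ?addr0 => [|s sr].
  by rewrite horner_prod; congr (_ * _); apply: eq_bigr => s _; rewrite hornerXsubC.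
by rewrite horner_prod (bigD1 s) //= hornerXsubC subrr !mul0r.
Qed.

Lemma idem_far_neq0 r : E r u v != 0.
Proof.
have : walk_count R e d u v != 0 by rewrite -duv dist_sym // lt0r_neq0 // walk_count_gt0.
by rewrite -(idem_far r) mulf_eq0 negb_or => /andP[].
Qed.

Lemma strongly_cospectral :
  \sum_(r < d.+1) (-1) ^+ r * E r u v = 1 ->
  forall (r : 'I_d.+1) x, E r x u = (-1) ^+ r * E r x v.
Proof.
move=> S1.
(* The squared norms of [E_r e_u - (-1)^r E_r e_v] add up to [1 + 1 - 2 = 0]. *)
have S0 : \sum_(r < d.+1) \sum_z (E r z u - (-1) ^+ r * E r z v) ^+ 2 = 0.
  under eq_bigr do rewrite idem_norm sqrr_sign mul1r -mulrA.
  by rewrite sumrB big_split /= -mulr_sumr S1 !sumE !eqxx mulr1; exact: subrr.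
move=> r x; apply/eqP; rewrite -subr_eq0 -sqrf_eq0; apply/eqP.
have Hge (s : 'I_d.+1) : true -> 0 <= \sum_z (E s z u - (-1) ^+ s * E s z v) ^+ 2.
  by move=> _; apply: sumr_ge0 => z _; exact: sqr_ge0.
have /psumr_eq0P H := @psumr_eq0P _ _ xpredT _ Hge S0 r isT.
by apply: H => // z _; exact: sqr_ge0.
Qed.

(** * Strong cospectrality makes the spheres equitable *)

Section StronglyCospectral.
Hypothesis Euv : forall (r : 'I_d.+1) x, E r x u = (-1) ^+ r * E r x v.
Hypothesis ones : exists q : 'I_d.+1 -> R, forall x, \sum_r q r * E r x u = 1.

Lemma geodesic_basis : exists w : 'I_d.+1 -> T -> R,
  [/\ forall i x, w i x != 0 -> dist e u x = i /\ (dist e u x + dist e v x)%N = d,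
      forall i, exists x, w i x != 0,
      forall i, exists q : 'I_d.+1 -> R, forall x, w i x = \sum_r q r * E r x u &
      forall q : 'I_d.+1 -> R, exists c : 'I_d.+1 -> R,
        forall x, \sum_r q r * E r x u = \sum_i c i * w i x].
Proof.
have sgn0 (r : 'I_d.+1) : (-1) ^+ r != 0 :> R by rewrite signr_eq0.
have /fin_all_exists [F HF] (i : 'I_d.+1) : exists fg : {poly R} * {poly R},
    [/\ (size fg.1 <= i.+1)%N, (size fg.2 <= (d - i).+1)%N, fg.1 != 0 &
        forall r : 'I_d.+1, fg.1.[theta r] = (-1) ^+ r * fg.2.[theta r]].
  have [f [g H]] := @two_poly_interpolation _ d i theta _ thI sgn0 (ltn_ord i).
  by exists (f, g).
(* [w i] is [f(A) e_u], which also equals [g(A) e_v]. *)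
pose w i x := \sum_r (F i).1.[theta r] * E r x u.
have supp i x : w i x != 0 -> dist e u x = i /\ (dist e u x + dist e v x)%N = d.
  have [sf sg _ fg] := HF i => wix.
  have ui : (dist e u x <= i)%N.
    rewrite leqNgt; apply: contraNN wix => lt; apply/eqP; apply: poly_spectral_far.
    by apply: leq_trans sf _; rewrite dist_sym.
  have vi : (dist e v x <= d - i)%N.
    rewrite leqNgt; apply: contraNN wix => lt; apply/eqP.
    rewrite -[RHS](@poly_spectral_far (F i).2 x v); last first.
      by apply: leq_trans sg _; rewrite dist_sym.
    by apply: eq_bigr => r _; rewrite fg Euv mulrACA -expr2 sqrr_sign mul1r.
  (* The bounds [i] and [d - i] add up to the distance of [u] and [v], so both are attained. *)
  have := dist_triangle econn u x v; rewrite duv (dist_sym e_sym econn x v).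
  have := ltn_ord i; lia.
have w_neq0 i : exists x, w i x != 0.
  have [sf _ f0 _] := HF i.
  have [/existsP//|/existsPn w0] := boolP [exists x, w i x != 0].
  case/eqP: f0; apply: (poly_eq0_on thI) => [|r]; first exact: leq_trans sf (ltn_ord i).
  (* Applying [E r] to [w i = 0] and reading at [v] gives [f(theta r) * E r v u = 0], so [f] would
     have [d + 1] roots. *)
  have := idem_comb (fun r => (F i).1.[theta r]) r v u.
  rewrite big1 => [/esym/eqP|z _]; last by have := w0 z; rewrite negbK /w => /eqP ->; rewrite mulr0.
  by rewrite mulf_eq0 Esym (negbTE (idem_far_neq0 r)) orbF => /eqP.
exists w; split=> // [i|]; first by exists (fun r => (F i).1.[theta r]).
(* Row [i] holds coefficients of [w i] on the vectors [E r e_u]; disjoint supports make [M]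
   invertible. *)
pose M : 'M[R]_d.+1 := \matrix_(i, r) (F i).1.[theta r].
have comb (c : 'rV[R]_d.+1) x : \sum_i c 0 i * w i x = \sum_r (c *m M) 0 r * E r x u.
  under eq_bigr do rewrite mulr_sumr.
  rewrite exchange_big /=; apply: eq_bigr => r _; rewrite mxE mulr_suml.
  by apply: eq_bigr => i _; rewrite mxE mulrA.
have Mu : M \in unitmx.
  rewrite -row_free_unit -kermx_eq0; apply/rowV0P => c /sub_kermxP cM.
  apply/rowP => i; rewrite mxE; have [x wix] := w_neq0 i.
  have [ui _] := supp _ _ wix.
  have := comb c x; rewrite cM (bigD1 i) //= [X in _ + X]big1 => [|j ji].
    by rewrite addr0 big1 => [/eqP|r _]; rewrite ?mxE ?mul0r // mulf_eq0 (negbTE wix) orbF => /eqP.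
  suff -> : w j x = 0 by rewrite mulr0.
  by apply/eqP; apply: contraNT ji => /supp [uj _]; apply/eqP/val_inj; rewrite /= -ui -uj.
move=> q; exists (fun i => (\row_r q r *m invmx M) 0 i) => x.
by rewrite comb mulmxKV //; apply: eq_bigr => r _; rewrite mxE.
Qed.

(** The all-ones vector is a combination of the [w i], which all vanish at a vertex off the
    geodesics from [u] to [v]. *)
Lemma strongly_cospectral_distance x : (dist e u x + dist e v x)%N = d.
Proof.
have [w [supp _ _ comb]] := geodesic_basis; have [q q1] := ones; have [c cE] := comb q.
have : \sum_i c i * w i x != 0 by rewrite -cE q1 oner_neq0.
apply: contraNeq => xd; apply/eqP; apply: big1 => i _.
by have [->|/supp [_ /eqP]] := eqVneq (w i x) 0; rewrite ?mulr0 // (negbTE xd).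
Qed.

Lemma strongly_cospectral_equitable (i : 'I_d.+1) x y : dist e u x = dist e u y ->
  \sum_z adj R e x z * (dist e u z == i)%:R = \sum_z adj R e y z * (dist e u z == i)%:R.
Proof.
have [w [supp w_neq0 wq comb]] := geodesic_basis; have [q q1] := ones; have [c cE] := comb q.
(* At each vertex at most one [w j] is nonzero, so expanding the all-ones vector makes [c j * w j]
   the indicator of a sphere. *)
have cw j z : c j * w j z = (dist e u z == j)%:R.
  case: eqVneq => [zj|zj]; last first.
    have [->|/supp [jz _]] := eqVneq (w j z) 0; first by rewrite mulr0.
    by rewrite jz eqxx in zj.
  rewrite -(q1 z) cE (bigD1 j) //= [X in _ + X]big1 ?addr0 // => k kj.
  have [->|/supp [kz _]] := eqVneq (w k z) 0; first by rewrite mulr0.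
  by case/eqP: kj; apply/val_inj; rewrite /= -kz -zj.
have c0 j : c j != 0.
  have [z wz] := w_neq0 j; have [zj _] := supp _ _ wz.
  have := cw j z; rewrite zj eqxx => /eqP; apply: contraTneq => ->.
  by rewrite mul0r eq_sym oner_neq0.
move=> xy.
have wxy j : w j x = w j y by apply: (mulfI (c0 j)); rewrite !cw xy.
have [q' q'E] := wq i; have [c' c'E] := comb (fun r => theta r * q' r).
(* [A w_i] stays in the Krylov space, hence is a combination of the [w j], each constant on
   spheres. *)
have adj_sphere z : \sum_t adj R e z t * (dist e u t == i)%:R = c i * \sum_j c' j * w j z.
  rewrite -c'E -adj_comb mulr_sumr; apply: eq_bigr => t _.
  by rewrite -cw q'E mulrCA.
by rewrite !adj_sphere; congr (_ * _); apply: eq_bigr => j _; rewrite wxy.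
Qed.

End StronglyCospectral.

(** * Equitable spheres make the projections proportional *)

Section EquitableSpheres.
Hypothesis diam : forall x, (dist e u x <= d)%N.
Hypothesis equit : forall x0 x y, dist e u x = dist e u y ->
  \sum_(z | dist e u z == dist e u x0) adj R e x z =
  \sum_(z | dist e u z == dist e u x0) adj R e y z.
Hypothesis v_only : forall x, dist e u x = d -> x = v.

Definition radial (h : T -> R) := forall x y, dist e u x = dist e u y -> h x = h y.

Lemma radial_adj h : radial h -> radial (fun x => \sum_z adj R e x z * h z).
Proof.
move=> hr x y xy.
pose p z : 'I_d.+1 := inord (dist e u z).
have pE z i : (p z == i) = (dist e u z == i).
  by rewrite -val_eqE /= inordK // ltnS diam.
rewrite [LHS](partition_big p xpredT) // [RHS](partition_big p xpredT) //=.
apply: eq_bigr => i _; rewrite (eq_bigl _ _ (pE^~ i)) [RHS](eq_bigl _ _ (pE^~ i)).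
(* [equit] indexes spheres by a vertex on them, so empty spheres are treated apart. *)
have [/existsP[z0 /eqP z0i]|/existsPn z0i] := boolP [exists z, dist e u z == i]; last first.
  by rewrite !big_pred0 // => z; apply: negbTE.
have hE t : \sum_(z | dist e u z == i) adj R e t z * h z =
    (\sum_(z | dist e u z == i) adj R e t z) * h z0.
  by rewrite mulr_suml; apply: eq_bigr => z /eqP zi; rewrite (hr z z0) // zi z0i.
by rewrite !hE -z0i (equit z0 xy).
Qed.

Lemma radial_walk_count k : radial (fun x => walk_count R e k x u).
Proof.
elim: k => [|k IH] /=; last exact: radial_adj IH.
by move=> x y xy; rewrite -!(eq_sym u) -!(dist_eq0 econn) xy.
Qed.

Lemma radial_comb h : radial h ->
  exists q : 'I_d.+1 -> R, forall x, h x = \sum_r q r * E r x u.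
Proof.
(* The values on the outermost sphere are killed by a multiple of [A^i e_u]. *)
suff H i : radial h -> (forall x, (i <= dist e u x)%N -> h x = 0) ->
    exists q : 'I_d.+1 -> R, forall x, h x = \sum_r q r * E r x u.
  by move=> hr; apply: (H d.+1) hr _ => x; rewrite ltnNge diam.
elim: i h => [|i IH] h hr h0.
  by exists (fun=> 0) => x; rewrite h0 // big1 // => r _; rewrite mul0r.
have [/existsP[x0 /eqP x0i]|/existsPn x0i] := boolP [exists x, dist e u x == i]; last first.
  apply: IH hr _ => x; rewrite leq_eqVlt eq_sym (negbTE (x0i x)) /=; exact: h0.
have W0 : walk_count R e i x0 u != 0 by rewrite lt0r_neq0 // -x0i walk_count_gt0.
pose c := h x0 / walk_count R e i x0 u.
case: (IH (fun x => h x - c * walk_count R e i x u)).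
- by move=> x y xy; rewrite (hr _ _ xy) (radial_walk_count i xy).
- move=> x; rewrite leq_eqVlt => /orP[/eqP xi|xi]; last first.
    by rewrite h0 // walk_count_eq0 // mulr0 subr0.
  have xx0 : dist e u x = dist e u x0 by rewrite x0i.
  by rewrite (hr _ _ xx0) (radial_walk_count i xx0) /c divfK // subrr.
(* [A^i e_u] has coefficients [theta r ^+ i]. *)
move=> q qE; exists (fun r => q r + c * theta r ^+ i) => x.
under eq_bigr do rewrite mulrDl -mulrA.
by rewrite big_split /= -qE -mulr_sumr -walk_count_spectral subrK.
Qed.

(** As [v] is alone on its sphere, [e_v] is radial and [E r e_v = q r * E r e_u]. Reading this at
    [u] and at [v], and using the equal diagonal entries, eliminates [q r]. *)
Lemma equitable_idem_sqr (r : 'I_d.+1) :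
  E r u u = E r v v -> E r u v ^+ 2 = E r u u ^+ 2.
Proof.
have [|q qE] := @radial_comb (fun x => (x == v)%:R).
  move=> x y xy; suff -> : (x == v) = (y == v) by [].
  by apply/eqP/eqP => zv; apply: v_only; rewrite -duv -zv ?xy.
have Ev y : E r y v = q r * E r y u.
  rewrite -idem_comb; under eq_bigr do rewrite -qE.
  by rewrite (bigD1 v) //= eqxx mulr1 big1 ?addr0 // => z /negbTE ->; rewrite mulr0.
move=> uv; have Euu : E r u u = q r * E r u v by rewrite uv Ev Esym.
by rewrite !expr2 {2}(Ev u) mulrA (mulrC (E r u v)) -Euu.
Qed.

End EquitableSpheres.

End Far.
End Idempotents.

(** * Signs, the principal idempotent and the equivalence *)

Lemma sign_prod_decreasing (R : realDomainType) (d : nat) (theta : 'I_d.+1 -> R) (r : 'I_d.+1) :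
  (forall r s : 'I_d.+1, (r < s)%N -> theta s < theta r) ->
  0 < (-1) ^+ r * \prod_(s | s != r) (theta r - theta s).
Proof.
move=> th.
(* Exactly the [r] factors with [s < r] are negative; each absorbs one sign. *)
have -> : (-1) ^+ r = \prod_(s < d.+1 | s != r) (if (s < r)%N then -1 else 1) :> R.
  rewrite -{1}(card_ord r) -prodr_const (big_ord_widen d.+1 (fun=> -1)); last exact: ltnW.
  by rewrite big_mkcond (bigD1 r) //= ltnn mul1r.
rewrite -big_split /=; apply: prodr_gt0 => s sr.
case: ltngtP => [lt|lt|/val_inj eq]; last by rewrite eq eqxx in sr.
  by rewrite mulN1r opprB subr_gt0 th.
by rewrite mul1r subr_gt0 th.
Qed.

(** Columns of [E ord0] are constant, and those of the other [E r] sum to zero, being orthogonal to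
    the all-ones vector. Summing a column of the identity gives the constant. *)
Lemma principal_idempotent (R : rcfType) (T : finType) (e : rel T) (k d : nat)
    (theta : 'I_d.+1 -> R) (E : 'I_d.+1 -> T -> T -> R) :
  symmetric e -> connected_graph e -> (forall x : T, #|[set y | e x y]| = k) ->
  injective theta -> theta ord0 = k%:R ->
  (forall x y, \sum_r E r x y = (x == y)%:R) ->
  (forall r x y, \sum_z adj R e x z * E r z y = theta r * E r x y) ->
  forall x y, #|T|%:R * E ord0 x y = 1.
Proof.
move=> e_sym econn ereg thI th0 sumE AE x y.
have E0 z : E ord0 z y = E ord0 x y.
  by apply: (@harmonic_const R T e k econn ereg (fun z => E ord0 z y)) => t; rewrite AE th0.
have Er r : r != ord0 -> \sum_z E r z y = 0.
  move=> r0; have : theta r * \sum_z E r z y = k%:R * \sum_z E r z y.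
    rewrite mulr_sumr; under eq_bigr do rewrite -AE.
    rewrite exchange_big mulr_sumr /=; apply: eq_bigr => z _.
    rewrite -mulr_suml -(@sum_adj R T e k ereg z); congr (_ * _).
    by apply: eq_bigr => t _; rewrite /adj e_sym.
  rewrite -th0 => /eqP; rewrite -subr_eq0 -mulrBl mulf_eq0 subr_eq0 (inj_eq thI).
  by rewrite (negbTE r0) => /eqP.
have : \sum_z \sum_r E r z y = 1.
  by under eq_bigr do rewrite sumE; rewrite (bigD1 y) //= eqxx big1 ?addr0 // => z /negbTE ->.
rewrite exchange_big (bigD1 ord0) //= [X in _ + X]big1 // addr0.
by under eq_bigr do rewrite E0; rewrite sumr_const mulr_natl.
Qed.

Theorem theorem3p7 (R : rcfType) (T : finType) (e : rel T) (d : nat)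
    (theta : 'I_d.+1 -> R) (u v : T) :
  simple_graph e -> connected_graph e -> regular_graph e ->
  diameter_is e d ->
  (forall r s : 'I_d.+1, (r < s)%N -> theta s < theta r) ->
  (forall a : R, eigenvalue (adjX R e) a <-> exists r : 'I_d.+1, a = theta r) ->
  dist e u v = d ->
  antipodal R e u v <->
  (#|T|%:R * \prod_(s < d.+1 | s != ord0) (theta ord0 - theta s)^-1 =
   \sum_(r < d.+1) (-1) ^+ r * \prod_(s < d.+1 | s != r) (theta r - theta s)^-1).
Proof.
move=> [e_sym _] econn [k ereg] [diam _] th eig duv.
have thI : injective theta.
  move=> r s rs; apply/val_inj => /=.
  by case: (ltngtP r s) => // /th; rewrite rs ltxx.
have [E [Esym sumE EE AE cosp]] := adj_spectral e_sym thI (fun a => proj1 (eig a)).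
have th0 : theta ord0 = k%:R.
  apply/eqP; rewrite eq_le; apply/andP; split.
    by apply: (eigenvalue_le_degree e_sym ereg); apply/eig; exists ord0.
  have /eig [r ->] := degree_eigenvalue R e_sym ereg u.
  by have [->//|r0] := eqVneq r ord0; apply/ltW/th; rewrite lt0n.
have E0 := principal_idempotent e_sym econn ereg thI th0 sumE AE.
pose m := walk_count R e d u v.
have m0 : 0 < m by rewrite /m -duv (dist_sym e_sym econn u v) walk_count_gt0.
have Ep r : E r u v = m * \prod_(s | s != r) (theta r - theta s)^-1.
  have P0 : \prod_(s | s != r) (theta r - theta s) != 0.
    by apply/prodf_neq0 => s sr; rewrite subr_eq0 (inj_eq thI) eq_sym.
  apply: (mulfI P0); rewrite (idem_far e_sym econn sumE AE duv) prodfV mulrCA divff //.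
  by rewrite mulr1.
have sgnE (r : 'I_d.+1) : 0 <= (-1) ^+ r * E r u v.
  rewrite Ep mulrCA mulr_ge0 ?(ltW m0) // prodfV -invr_sign -invfM invr_ge0 ltW //.
  exact: sign_prod_decreasing.
(* Multiplying by [m] turns the left side into [n * E ord0 u v = 1]. *)
have -> : (#|T|%:R * \prod_(s < d.+1 | s != ord0) (theta ord0 - theta s)^-1 =
   \sum_(r < d.+1) (-1) ^+ r * \prod_(s < d.+1 | s != r) (theta r - theta s)^-1)
   <-> \sum_(r < d.+1) (-1) ^+ r * E r u v = 1.
  under [X in _ <-> X = _]eq_bigr do rewrite Ep mulrCA.
  rewrite -mulr_sumr; have c1 := E0 u v; rewrite Ep mulrCA in c1.
  by split=> [<- //|mS]; apply: (mulfI (lt0r_neq0 m0)); rewrite c1 mS.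
split=> [[[P [Pu [_ [Peq [_ [vP _]]]]]] cuv]|S1].
  (* The constant Perron vector reduces pseudo equitability to equitability. *)
  have equit x0 x y : dist e u x = dist e u y ->
      \sum_(z | dist e u z == dist e u x0) adj R e x z =
      \sum_(z | dist e u z == dist e u x0) adj R e y z.
    move=> xy; have := Peq _ (perron_vector_one R e_sym ereg u)
      [set w | dist e u w == dist e u x0] [set w | dist e u w == dist e u x].
    rewrite Pu !imset_f // => /(_ isT isT x y); rewrite !inE xy eqxx => /(_ isT isT).
    under eq_bigr do rewrite mulr1 divr1.
    under [RHS]eq_bigr do rewrite mulr1 divr1.
    under eq_bigl do rewrite inE.
    by under [RHS]eq_bigl do rewrite inE.
  have v_only x : dist e u x = d -> x = v.
    move: vP; rewrite Pu => /imsetP[x0 _ /setP vE] ux.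
    have := vE v; rewrite !inE eqxx duv => /esym/eqP dx0.
    by have := vE x; rewrite !inE ux dx0 eqxx => /eqP.
  (* Compare term by term with [\sum_r E r u u = 1]; both terms are nonnegative, so equal squares
     suffice. *)
  transitivity (\sum_r E r u u); last by rewrite sumE eqxx.
  apply: eq_bigr => r _.
  have Ege : 0 <= E r u u.
    have := EE r r u u; rewrite eqxx mul1r => <-; apply: sumr_ge0 => z _.
    by rewrite (Esym r z u) -expr2 sqr_ge0.
  apply/eqP; rewrite -(@eqrXn2 _ 2) // exprMn sqrr_sign mul1r.
  apply/eqP; apply: (equitable_idem_sqr e_sym econn Esym sumE EE AE duv (diam u) equit v_only).
  exact/(cosp u v).1.
have Euv := strongly_cospectral Esym sumE EE S1.
(* All entries of [E ord0] are [1/n], so the all-ones vector is [n E_0 e_u]. *)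
have ones : exists q : 'I_d.+1 -> R, forall x, \sum_r q r * E r x u = 1.
  exists (fun r => #|T|%:R * (r == ord0)%:R) => x.
  rewrite (bigD1 ord0) //= mulr1 E0 big1 ?addr0 // => r /negbTE ->.
  by rewrite mulr0 mul0r.
have geo := strongly_cospectral_distance e_sym econn thI Esym sumE EE AE duv Euv ones.
have equit := strongly_cospectral_equitable e_sym econn thI Esym sumE EE AE duv Euv ones.
split; last first.
  by apply/cosp => r; rewrite Euv Esym Euv mulrA -expr2 sqrr_sign mul1r.
(* Distances from [u] and [v] add up to [d], so both vertices have the same spheres. *)
exists (dist_partition e u); split=> //; split.
  apply: eq_imset => x; apply/setP => w; rewrite !inE.
  by have := geo x; have := geo w; lia.
split.
  move=> phi phiP C B /imsetP[x0 _ ->] /imsetP[y0 _ ->] x y; rewrite !inE => /eqP xy0 /eqP yy0.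
  have phic := perron_vector_const e_sym econn ereg phiP.
  have phi0 z : phi z != 0 by have [a [_ _ p0 _]] := phiP; rewrite lt0r_neq0.
  have sumC t : \sum_(z in [set w | dist e u w == dist e u x0]) adj R e t z * phi z / phi t =
      \sum_z adj R e t z * (dist e u z == (inord (dist e u x0) : 'I_d.+1))%:R.
    rewrite big_mkcond; apply: eq_bigr => z _; rewrite inE inordK ?ltnS //.
    by rewrite (phic z t) mulfK //; case: eqP; rewrite ?mulr1 ?mulr0.
  by rewrite !sumC; apply: equit; rewrite xy0.
split; last split.
- apply/imsetP; exists u => //; apply/setP => w; rewrite !inE.
  have /eqP -> : dist e u u == 0%N by rewrite dist_eq0.
  by rewrite dist_eq0 // eq_sym.
- apply/imsetP; exists v => //; apply/setP => w; rewrite !inE duv.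
  have := geo w; rewrite -(dist_eq0 econn w v) (dist_sym e_sym econn w v); lia.
by move=> x y; rewrite duv.
Qed.
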